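(* Let $\Phi\subseteq\{I,O,U,\mathit{Self},Q_n,N_n\mid n\in\mathbb N\setminus\{0\}\}$ and let $\mathcal I$ and $\mathcal I'$ be fuzzy interpretations that are witnessed and modally saturated w.r.t. $\mathcal L'_\Phi$. Let $Z:\Delta^{\mathcal I}\times\Delta^{\mathcal I'}\to[0,1]$ be defined by $Z(x,x')=\inf\{C^{\mathcal I}(x)\Leftrightarrow C^{\mathcal I'}(x')\mid C\text{ is a concept of }\mathcal L'_\Phi\}$. Then $Z$ is a fuzzy $\Phi$-bisimulation between $\mathcal I$ and $\mathcal I'$, and $Z'\le Z$ pointwise for every fuzzy $\Phi$-bisimulation $Z'$ between $\mathcal I$ and $\mathcal I'$ (i.e. $Z$ is the greatest one).
   Context: Gödel operations on $[0,1]$: $p\otimes q=\min\{p,q\}$, $p\oplus q=\max\{p,q\}$, $\ominus p=1$ if $p=0$ and $0$ otherwise, $(p\Rightarrow q)=1$ if $p\le q$ and $q$ otherwise, $(p\Leftrightarrow q)=(p\Rightarrow q)\otimes(q\Rightarrow p)$. Fix pairwise disjoint sets $\mathsf{CN}$, $\mathsf{RN}$, $\mathsf{IN}$ of concept, role and individual names. A basic role w.r.t. $\Phi$ is $r\in\mathsf{RN}$, or $r^-$ when $I\in\Phi$. Roles and concepts of $\mathcal L_\Phi$: each $r\in\mathsf{RN}$ is a role; if $R,S$ are roles and $C$ a concept then $R\circ S$, $R\sqcup S$, $R^*$, $C?$ are roles; $R^-$ if $I\in\Phi$; $U$ if $U\in\Phi$; concepts: $p\in[0,1]$, $A\in\mathsf{CN}$,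 $C\sqcap D$, $C\to D$, $\neg C$, $C\sqcup D$, $\forall R.C$, $\exists R.C$; $\{a\}$ ($a\in\mathsf{IN}$) if $O\in\Phi$; $\exists r.\mathit{Self}$ if $\mathit{Self}\in\Phi$; ${\ge}n\,R.C$, ${<}n\,R.C$ for basic $R$ if $Q_n\in\Phi$; ${\ge}n\,R$, ${<}n\,R$ for basic $R$ if $N_n\in\Phi$. $\top$ is concept $1$. $\mathcal L'_\Phi$ is the largest sublanguage of $\mathcal L_\Phi$ that does not use the role constructors $R\circ S$, $R\sqcup S$, $R^*$, $C?$ nor the concept constructors $\neg C$, $C\sqcup D$, $\forall R.C$, ${<}n\,R.C$, ${<}n\,R$, and which, in case no $Q_n$ belongs to $\Phi$, uses $\to$ only in the forms $C\to p$ or $p\to C$ with $p\in[0,1]$. A fuzzy interpretation $\mathcal I$ has a nonempty domain $\Delta^{\mathcal I}$, $a^{\mathcal I}\in\Delta^{\mathcal I}$, $A^{\mathcal I}:\Delta^{\mathcal I}\to[0,1]$, $r^{\mathcal I}:(\Delta^{\mathcal I})^2\to[0,1]$, extended by: $U^{\mathcal I}\equiv1$; $(R^-)^{\mathcal I}(x,y)=R^{\mathcal I}(y,x)$; $(C?)^{\mathcal I}(x,y)=C^{\mathcal I}(x)$ if $x=y$, else $0$; $(R\circ S)^{\mathcal I}(x,y)=\sup_z R^{\mathcal I}(x,z)\otimes S^{\mathcal I}(z,y)$; $(R\sqcup S)^{\mathcal I}=R^{\mathcal I}\oplus S^{\mathcal I}$; $(R^* )^{\mathcal I}(x,y)=\sup\{\min(\{1\}\cup\{R^{\mathcal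 I}(x_i,x_{i+1})\mid i<n\})\mid n\ge0,x_0=x,x_n=y\}$; $p^{\mathcal I}(x)=p$; $\{a\}^{\mathcal I}(x)=1$ iff $x=a^{\mathcal I}$, else $0$; $(\neg C)^{\mathcal I}=\ominus C^{\mathcal I}$; $\sqcap,\sqcup,\to$ pointwise by $\otimes,\oplus,\Rightarrow$; $(\exists r.\mathit{Self})^{\mathcal I}(x)=r^{\mathcal I}(x,x)$; $(\exists R.C)^{\mathcal I}(x)=\sup_y R^{\mathcal I}(x,y)\otimes C^{\mathcal I}(y)$; $(\forall R.C)^{\mathcal I}(x)=\inf_y(R^{\mathcal I}(x,y)\Rightarrow C^{\mathcal I}(y))$; $({\ge}n\,R.C)^{\mathcal I}(x)=\sup\{\min_i(R^{\mathcal I}(x,y_i)\otimes C^{\mathcal I}(y_i))\mid y_1..y_n$ pairwise distinct$\}$; $({<}n\,R.C)^{\mathcal I}(x)=\inf\{\min_i(R^{\mathcal I}(x,y_i)\otimes C^{\mathcal I}(y_i))\Rightarrow e\mid y_1..y_n\}$ with $e=1$ if some $y_j=y_k$ ($j<k$), else $0$; ${\ge}n\,R={\ge}n\,R.\top$, ${<}n\,R={<}n\,R.\top$. Witnessed w.r.t. $\mathcal L'_\Phi$: for roles/concepts of $\mathcal L'_\Phi$, every infinite set whose infimum (supremum) is taken above has a least (greatest) element. $\mathcal I$ is modally saturated w.r.t. $\mathcal L'_\Phi$ if: (1) for every $p\in(0,1]$, $x\in\Delta^{\mathcal I}$, basic role $R$ and infinite set $\Gamma$ of concepts of $\mathcal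 L'_\Phi$: if for every finite $\Lambda\subseteq\Gamma$ there is $y$ with $R^{\mathcal I}(x,y)\otimes C^{\mathcal I}(y)\ge p$ for all $C\in\Lambda$, then there is $y$ with $R^{\mathcal I}(x,y)\otimes C^{\mathcal I}(y)\ge p$ for all $C\in\Gamma$; (2) if $Q_n\in\Phi$: for all such $p,x,R,\Gamma$, if for every finite $\Lambda\subseteq\Gamma$ there are pairwise distinct $y_1..y_n$ with $R^{\mathcal I}(x,y_i)\otimes C^{\mathcal I}(y_i)\ge p$ for all $i$ and $C\in\Lambda$, then there are pairwise distinct $y_1..y_n$ with this for all $i$ and $C\in\Gamma$; (3) if $U\in\Phi$: for every $p\in(0,1]$ and infinite set $\Gamma$ of concepts of $\mathcal L'_\Phi$, if for every finite $\Lambda\subseteq\Gamma$ there is $y$ with $C^{\mathcal I}(y)\ge p$ for all $C\in\Lambda$, then there is $y$ with $C^{\mathcal I}(y)\ge p$ for all $C\in\Gamma$. A fuzzy $\Phi$-bisimulation between $\mathcal I,\mathcal I'$ is $Z:\Delta^{\mathcal I}\times\Delta^{\mathcal I'}\to[0,1]$ with, for all $x,x',A\in\mathsf{CN},a\in\mathsf{IN},r\in\mathsf{RN}$ and basic $R$: (i) $Z(x,x')\le(A^{\mathcal I}(x)\Leftrightarrow A^{\mathcal I'}(x'))$; (ii) $\forall y\exists y'$: $Z(x,x')\otimes R^{\mathcal I}(x,y)\le Z(y,y')\otimes R^{\mathcal I'}(x',y')$; (iii) $\forall y'\exists y$: $Z(x,x')\otimes R^{\mathcal I'}(x',y')\le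 Z(y,y')\otimes R^{\mathcal I}(x,y)$; (iv) if $O\in\Phi$: $Z(x,x')=0$ whenever exactly one of $x=a^{\mathcal I}$, $x'=a^{\mathcal I'}$ holds; (v) if $U\in\Phi$: $\forall y\exists y'$ $Z(x,x')\le Z(y,y')$ and $\forall y'\exists y$ $Z(x,x')\le Z(y,y')$; (vi) if $\mathit{Self}\in\Phi$: $Z(x,x')\le(r^{\mathcal I}(x,x)\Leftrightarrow r^{\mathcal I'}(x',x'))$; (vii) if $Q_n\in\Phi$: if $Z(x,x')>0$ and $y_1..y_n$ pairwise distinct with all $R^{\mathcal I}(x,y_j)>0$, there exist pairwise distinct $y'_1..y'_n$ such that for each $i$ some $j$ has $Z(x,x')\otimes\bigotimes_k R^{\mathcal I}(x,y_k)\le Z(y_j,y'_i)\otimes R^{\mathcal I'}(x',y'_i)$, and symmetrically (from pairwise distinct $y'_1..y'_n$ with $R^{\mathcal I'}(x',y'_j)>0$ obtain pairwise distinct $y_1..y_n$ such that for each $i$ some $j$ has $Z(x,x')\otimes\bigotimes_k R^{\mathcal I'}(x',y'_k)\le Z(y_i,y'_j)\otimes R^{\mathcal I}(x,y_i)$); (viii) if $N_n\in\Phi$: as (vii) with right-hand sides $R^{\mathcal I'}(x',y'_i)$ for all $i$, resp. $R^{\mathcal I}(x,y_i)$ for all $i$. *)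

(* Defs.v *)
From mathcomp Require Import all_boot all_order all_algebra.
From mathcomp Require Import boolp classical_sets cardinality reals.

Set Implicit Arguments.
Unset Strict Implicit.
Unset Printing Implicit Defensive.

Import Order.TTheory GRing.Theory Num.Theory.
Local Open Scope classical_set_scope.
Local Open Scope ring_scope.

(* Truth values are reals; membership in [0,1] is imposed where a value is
   introduced: constants of the language, interpretations, bisimulations. *)
Section Godel.
Variable R : realType.
Implicit Types p q : R.

Definition gand p q : R := Num.min p q.
Definition gor p q : R := Num.max p q.
Definition gnot p : R := if p == 0 then 1 else 0.
Definition gimp p q : R := if p <= q then 1 else q.
Definition giff p q : R := gand (gimp p q) (gimp q p).

(* As all truth values are at most 1, the minimum of [F] over i < n when
   0 < n, and 1 when n = 0. *)
Definition gmin n (F : 'I_n -> R) : R := \big[Num.min/1]_(i < n) F i.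

End Godel.

Inductive feature : Type :=
  | FInv | FNom | FUniv | FSelf
  | FQual of nat  (* Q_n *)
  | FNum of nat.  (* N_n *)

Definition features : set feature :=
  [set f | match f with FQual n | FNum n => (0 < n)%N | _ => True end].

Section Syntax.
Variables (R : realType) (CN RN IN : Type).

(* Raw expressions; the language of a given [Phi] is carved out by
   [lang_role] and [lang_concept]. Using separate types of names makes CN, RN
   and IN pairwise disjoint. *)
Inductive role : Type :=
  | RName of RN
  | RInv of role
  | RUniv
  | RComp of role & role
  | RUnion of role & role
  | RStar of role
  | RTest of concept
with concept : Type :=
  | CConst of R
  | CName of CN
  | CNom of IN
  | CSelf of RN
  | CNot of concept
  | CAnd of concept & concept
  | COr of concept & concept
  | CImp of concept & concept
  | CAll of role & concept
  | CEx of role & concept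
  | CGeQ of nat & role & concept   (* >= n R.C *)
  | CLtQ of nat & role & concept   (* < n R.C *)
  | CGeN of nat & role             (* >= n R *)
  | CLtN of nat & role.            (* < n R *)

Variable Phi : set feature.

Definition basic_role (T : role) : Prop :=
  match T with
  | RName _ => True
  | RInv (RName _) => Phi FInv
  | _ => False
  end.

Fixpoint lang_role (T : role) : Prop :=
  match T with
  | RName _ => True
  | RInv T1 => Phi FInv /\ lang_role T1
  | RUniv => Phi FUniv
  | RComp T1 T2 | RUnion T1 T2 => lang_role T1 /\ lang_role T2
  | RStar T1 => lang_role T1
  | RTest C => lang_concept C
  end
with lang_concept (C : concept) : Prop :=
  match C with
  | CConst p => 0 <= p <= 1
  | CName _ => True
  | CNom _ => Phi FNom
  | CSelf _ => Phi FSelf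
  | CNot D => lang_concept D
  | CAnd D E | COr D E | CImp D E => lang_concept D /\ lang_concept E
  | CAll T D | CEx T D => lang_role T /\ lang_concept D
  | CGeQ n T D | CLtQ n T D =>
      [/\ Phi (FQual n), basic_role T & lang_concept D]
  | CGeN n T | CLtN n T => Phi (FNum n) /\ basic_role T
  end.

Definition is_const (C : concept) : Prop :=
  match C with CConst _ => True | _ => False end.

Fixpoint restricted_role (T : role) : Prop :=
  match T with
  | RName _ | RUniv => True
  | RInv T1 => restricted_role T1
  | RComp _ _ | RUnion _ _ | RStar _ | RTest _ => False
  end.

Fixpoint restricted_concept (C : concept) : Prop :=
  match C with
  | CConst _ | CName _ | CNom _ | CSelf _ => True
  | CAnd D E => restricted_concept D /\ restricted_concept E
  | CImp D E =>
      [/\ restricted_concept D, restricted_concept E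
        & (exists n, Phi (FQual n)) \/ is_const D \/ is_const E]
  | CEx T D | CGeQ _ T D => restricted_role T /\ restricted_concept D
  | CGeN _ T => restricted_role T
  | CNot _ | COr _ _ | CAll _ _ | CLtQ _ _ _ | CLtN _ _ => False
  end.

(* The sublanguage L'_Phi. *)
Definition lang'_role : set role :=
  [set T | lang_role T /\ restricted_role T].

Definition lang'_concept : set concept :=
  [set C | lang_concept C /\ restricted_concept C].

End Syntax.

Section Semantics.
Variables (R : realType) (CN RN IN : Type).

Record fuzzy_interp := FuzzyInterp {
  dom : Type;
  dom_inhabited : inhabited dom;
  ind : IN -> dom;
  cname : CN -> dom -> R;
  rname : RN -> dom -> dom -> R;
  cname01 : forall A x, 0 <= cname A x <= 1;
  rname01 : forall r x y, 0 <= rname r x y <= 1 }.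

(* The sets of truth values whose suprema and infima define the semantics.
   Note that [sup set0 = 0], as in the complete lattice [0,1]; only [geq_vals]
   can be empty, and the sets subject to [inf] are nonempty. *)
Section Values.
Variable D : Type.
Implicit Types (f g : D -> D -> R) (c : D -> R).

Definition comp_vals f g x y : set R :=
  [set v | exists z, v = gand (f x z) (g z y)].

Definition star_vals f x y : set R :=
  [set v | exists n (s : nat -> D), [/\ s 0%N = x, s n = y
    & v = gmin (fun i : 'I_n => f (s i) (s i.+1))]].

Definition ex_vals f c x : set R :=
  [set v | exists y, v = gand (f x y) (c y)].

Definition all_vals f c x : set R :=
  [set v | exists y, v = gimp (f x y) (c y)].

Definition geq_vals n f c x : set R :=
  [set v | exists2 y : 'I_n -> D, injective y
    & v = gmin (fun i => gand (f x (y i)) (c (y i)))].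

Definition lt_vals n f c x : set R :=
  [set v | exists y : 'I_n -> D,
    v = gimp (gmin (fun i => gand (f x (y i)) (c (y i))))
             (if `[< injective y >] then 0 else 1)].

End Values.

Variable J : fuzzy_interp.
Let D := dom J.

Fixpoint reval (T : role R CN RN IN) : D -> D -> R :=
  match T with
  | RName r => rname r
  | RInv T1 => fun x y => reval T1 y x
  | RUniv => fun _ _ => 1
  | RComp T1 T2 => fun x y => sup (comp_vals (reval T1) (reval T2) x y)
  | RUnion T1 T2 => fun x y => gor (reval T1 x y) (reval T2 x y)
  | RStar T1 => fun x y => sup (star_vals (reval T1) x y)
  | RTest C => fun x y => if `[< x = y >] then ceval C x else 0
  end
with ceval (C : concept R CN RN IN) : D -> R :=
  match C with
  | CConst p => fun _ => p
  | CName A => cname A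
  | CNom a => fun x => if `[< x = ind J a >] then 1 else 0
  | CSelf r => fun x => rname r x x
  | CNot C1 => fun x => gnot (ceval C1 x)
  | CAnd C1 C2 => fun x => gand (ceval C1 x) (ceval C2 x)
  | COr C1 C2 => fun x => gor (ceval C1 x) (ceval C2 x)
  | CImp C1 C2 => fun x => gimp (ceval C1 x) (ceval C2 x)
  | CAll T C1 => fun x => inf (all_vals (reval T) (ceval C1) x)
  | CEx T C1 => fun x => sup (ex_vals (reval T) (ceval C1) x)
  | CGeQ n T C1 => fun x => sup (geq_vals n (reval T) (ceval C1) x)
  | CLtQ n T C1 => fun x => inf (lt_vals n (reval T) (ceval C1) x)
  | CGeN n T => fun x => sup (geq_vals n (reval T) (fun=> 1) x)
  | CLtN n T => fun x => inf (lt_vals n (reval T) (fun=> 1) x)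
  end.

Definition sup_witnessed (A : set R) : Prop :=
  infinite_set A -> exists2 m, A m & ubound A m.

Definition inf_witnessed (A : set R) : Prop :=
  infinite_set A -> exists2 m, A m & lbound A m.

(* Witnessedness w.r.t. an arbitrary language, given by its roles [LR] and its
   concepts [LC]; several clauses are void for the languages L'_Phi. *)
Definition witnessed_wrt (LR : set (role R CN RN IN))
    (LC : set (concept R CN RN IN)) : Prop :=
  (forall T, LR T -> forall x y,
     match T with
     | RComp T1 T2 => sup_witnessed (comp_vals (reval T1) (reval T2) x y)
     | RStar T1 => sup_witnessed (star_vals (reval T1) x y)
     | _ => True
     end) /\
  (forall C, LC C -> forall x,
     match C with
     | CAll T C1 => inf_witnessed (all_vals (reval T) (ceval C1) x)
     | CEx T C1 => sup_witnessed (ex_vals (reval T) (ceval C1) x)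
     | CGeQ n T C1 => sup_witnessed (geq_vals n (reval T) (ceval C1) x)
     | CLtQ n T C1 => inf_witnessed (lt_vals n (reval T) (ceval C1) x)
     | CGeN n T => sup_witnessed (geq_vals n (reval T) (fun=> 1) x)
     | CLtN n T => inf_witnessed (lt_vals n (reval T) (fun=> 1) x)
     | _ => True
     end).

Definition witnessed (Phi : set feature) : Prop :=
  witnessed_wrt (lang'_role Phi) (lang'_concept Phi).

Record modally_saturated (Phi : set feature) : Prop := ModallySaturated {
  msat_role : forall (p : R) (x : D) (T : role R CN RN IN)
      (Gamma : set (concept R CN RN IN)),
    0 < p <= 1 -> basic_role Phi T ->
    Gamma `<=` lang'_concept Phi -> infinite_set Gamma ->
    (forall Lambda, Lambda `<=` Gamma -> finite_set Lambda ->
       exists y, forall C, Lambda C -> p <= gand (reval T x y) (ceval C y)) ->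
    exists y, forall C, Gamma C -> p <= gand (reval T x y) (ceval C y);
  msat_qual : forall n, Phi (FQual n) ->
    forall (p : R) (x : D) (T : role R CN RN IN)
      (Gamma : set (concept R CN RN IN)),
    0 < p <= 1 -> basic_role Phi T ->
    Gamma `<=` lang'_concept Phi -> infinite_set Gamma ->
    (forall Lambda, Lambda `<=` Gamma -> finite_set Lambda ->
       exists2 y : 'I_n -> D, injective y & forall i C, Lambda C ->
         p <= gand (reval T x (y i)) (ceval C (y i))) ->
    exists2 y : 'I_n -> D, injective y & forall i C, Gamma C ->
      p <= gand (reval T x (y i)) (ceval C (y i));
  msat_univ : Phi FUniv ->
    forall (p : R) (Gamma : set (concept R CN RN IN)),
    0 < p <= 1 ->
    Gamma `<=` lang'_concept Phi -> infinite_set Gamma ->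
    (forall Lambda, Lambda `<=` Gamma -> finite_set Lambda ->
       exists y, forall C, Lambda C -> p <= ceval C y) ->
    exists y, forall C, Gamma C -> p <= ceval C y }.

End Semantics.

Section Bisimulation.
Variables (R : realType) (CN RN IN : Type) (Phi : set feature).
Variables I I' : fuzzy_interp R CN RN IN.

Record fuzzy_bisim (Z : dom I -> dom I' -> R) : Prop := FuzzyBisim {
  bisim01 : forall x x', 0 <= Z x x' <= 1;
  bisim_name : forall x x' A, Z x x' <= giff (cname A x) (cname A x');
  bisim_forth : forall x x' (T : role R CN RN IN), basic_role Phi T ->
    forall y, exists y',
      gand (Z x x') (reval T x y) <= gand (Z y y') (reval T x' y');
  bisim_back : forall x x' (T : role R CN RN IN), basic_role Phi T ->
    forall y', exists y,
      gand (Z x x') (reval T x' y') <= gand (Z y y') (reval T x y);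
  bisim_nom : Phi FNom -> forall x x' a,
    ~ (x = ind I a <-> x' = ind I' a) -> Z x x' = 0;
  bisim_univ_forth : Phi FUniv ->
    forall x x' y, exists y', Z x x' <= Z y y';
  bisim_univ_back : Phi FUniv ->
    forall x x' y', exists y, Z x x' <= Z y y';
  bisim_self : Phi FSelf -> forall x x' r,
    Z x x' <= giff (rname r x x) (rname r x' x');
  bisim_qual_forth : forall n, Phi (FQual n) ->
    forall x x' (T : role R CN RN IN), basic_role Phi T -> 0 < Z x x' ->
    forall y : 'I_n -> dom I, injective y ->
    (forall j, 0 < reval T x (y j)) ->
    exists2 y' : 'I_n -> dom I', injective y' &
      forall i, exists j,
        gand (Z x x') (gmin (fun k => reval T x (y k)))
          <= gand (Z (y j) (y' i)) (reval T x' (y' i));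
  bisim_qual_back : forall n, Phi (FQual n) ->
    forall x x' (T : role R CN RN IN), basic_role Phi T -> 0 < Z x x' ->
    forall y' : 'I_n -> dom I', injective y' ->
    (forall j, 0 < reval T x' (y' j)) ->
    exists2 y : 'I_n -> dom I, injective y &
      forall i, exists j,
        gand (Z x x') (gmin (fun k => reval T x' (y' k)))
          <= gand (Z (y i) (y' j)) (reval T x (y i));
  bisim_num_forth : forall n, Phi (FNum n) ->
    forall x x' (T : role R CN RN IN), basic_role Phi T -> 0 < Z x x' ->
    forall y : 'I_n -> dom I, injective y ->
    (forall j, 0 < reval T x (y j)) ->
    exists2 y' : 'I_n -> dom I', injective y' &
      forall i, gand (Z x x') (gmin (fun k => reval T x (y k)))
                  <= reval T x' (y' i);
  bisim_num_back : forall n, Phi (FNum n) ->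
    forall x x' (T : role R CN RN IN), basic_role Phi T -> 0 < Z x x' ->
    forall y' : 'I_n -> dom I', injective y' ->
    (forall j, 0 < reval T x' (y' j)) ->
    exists2 y : 'I_n -> dom I, injective y &
      forall i, gand (Z x x') (gmin (fun k => reval T x' (y' k)))
                  <= reval T x (y i) }.

End Bisimulation.

(* Main.v *)
(* Call Z(x,x') the logical similarity of x and x'. By residuation, a bound
   z <= (C(x) <=> C(x')) says that C transfers below z in both directions, that
   is, p <= C(x) iff p <= C(x') for all p <= z. A structural induction shows
   that every bisimulation value is such a bound, so Z is above all
   bisimulations.

   That Z satisfies the back and forth conditions is a Hennessy-Milner argument.
   Given y (or y_1, ..., y_n), let p be the left-hand side of the condition and
   let G be the set of concepts with value 1 at all the given points. For a
   finite part of G with conjunction D, the concept [exists T.D] (or [>= n T.D])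
   has value at least p at x, hence at x', and the supremum is attained there by
   witnessedness; modal saturation then gives one choice of y' for the whole
   of G. This y' is similar enough to y because G contains (C <=> c) for every C
   with value c at y. For Q_n, if some y'_i had similarity less than p to every
   y_j, the disjunction over j of concepts (C_j <=> c_j) separating y_j from
   y'_i would be in G and have value less than p at y'_i; this disjunction is
   expressible as ((C -> D) -> D) and ((D -> C) -> C), since implication is
   unrestricted in the presence of some Q_n. *)

Require Import Defs.
From mathcomp Require Import all_boot all_order all_algebra.
From mathcomp Require Import boolp classical_sets cardinality reals.

Set Implicit Arguments.
Unset Strict Implicit.
Unset Printing Implicit Defensive.

Import Order.TTheory GRing.Theory Num.Theory.
Local Open Scope classical_set_scope.
Local Open Scope ring_scope.

(** * Residuation, thresholds and suprema of truth values *)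

Section GodelTheory.
Variable R : realType.
Implicit Types (p q z : R) (A : set R).

Lemma giffC p q : giff p q = giff q p.
Proof. by rewrite /giff /gand minC. Qed.

(** Residuation. The bound [z <= 1] settles the case [p <= q], where the implication takes the value
    1. *)
Lemma le_gimp z p q : z <= 1 -> (z <= gimp p q) = (gand z p <= q).
Proof.
rewrite /gimp /gand ge_min => z1; case: (leP p q) => pq.
  by rewrite z1 orbT.
by rewrite orbF.
Qed.

Lemma le_giff z p q :
  z <= 1 -> (z <= giff p q) = (gand z p <= q) && (gand z q <= p).
Proof. by move=> z1; rewrite /giff /gand le_min !le_gimp. Qed.

Lemma gimp01 p q : 0 <= q <= 1 -> 0 <= gimp p q <= 1.
Proof. by rewrite /gimp; case: ifP => // _ _; rewrite ler01 lexx. Qed.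

Lemma gand01 p q : 0 <= p <= 1 -> 0 <= q <= 1 -> 0 <= gand p q <= 1.
Proof.
move=> /andP[p0 p1] /andP[q0 q1].
by rewrite /gand le_min p0 q0 ge_min p1.
Qed.

Lemma giff01 p q : 0 <= p <= 1 -> 0 <= q <= 1 -> 0 <= giff p q <= 1.
Proof. by move=> *; apply: gand01; apply: gimp01. Qed.

Lemma giffxx p : giff p p = 1.
Proof. by rewrite /giff /gimp /gand lexx minxx. Qed.

(** Serves to replace [COr], which the sublanguage lacks. For [p < q] the two factors are [q] and 1,
    symmetrically for [q < p], and for [p = q] both equal [p]. *)
Lemma gimp_join p q : p <= 1 -> q <= 1 ->
  gand (gimp (gimp p q) q) (gimp (gimp q p) p) = Num.max p q.
Proof.
move=> p1 q1.
have gimp1 (r : R) : r <= 1 -> gimp 1 r = r.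
  by move=> r1; rewrite /gimp; case: leP => // r1'; apply/le_anti/andP.
have gimp_le (r s : R) : r <= s -> gimp r s = 1 by rewrite /gimp => ->.
have gimp_lt (r s : R) : s < r -> gimp r s = s.
  by rewrite /gimp ltNge => /negbTE->.
have [pq|qp] := leP p q.
  rewrite (gimp_le p q) // gimp1 // /gand min_l //.
  have [qp|pq'] := leP q p; first by rewrite (gimp_le q p) // gimp1.
  by rewrite (gimp_lt q p) // gimp_le.
rewrite (gimp_lt p q) // (gimp_le q p) ?(ltW qp) // (gimp_le q q) // gimp1 //.
by rewrite /gand min_r.
Qed.

Lemma le_gmin n (F : 'I_n -> R) p :
  p <= 1 -> reflect (forall i, p <= F i) (p <= gmin F).
Proof.
move=> p1; apply: (iffP (bigmin_geP _ _ _ _)) => [[_ h] i|h]; first exact: h.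
by split.
Qed.

Lemma gmin_le1 n (F : 'I_n -> R) : gmin F <= 1.
Proof. exact: bigmin_le_id. Qed.

Lemma gmin_le n (F : 'I_n -> R) i : gmin F <= F i.
Proof. exact: bigmin_le_cond. Qed.

Lemma sup01 A : (forall v, A v -> 0 <= v <= 1) -> 0 <= sup A <= 1.
Proof.
move=> A01; have [->|A0] := eqVneq A set0; first by rewrite sup0 lexx ler01.
move/set0P: A0 => [v Av]; have /andP[v0 _] := A01 _ Av.
apply/andP; split.
- apply: le_trans v0 _; apply: ub_le_sup => //.
  by exists 1 => w /A01 /andP[].
- by apply: ge_sup; [exists v | move=> w /A01 /andP[]].
Qed.

Lemma le_sup01 A v : (forall v, A v -> 0 <= v <= 1) -> A v -> v <= sup A.
Proof. by move=> A01; apply: ub_le_sup; exists 1 => w /A01 /andP[]. Qed.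

Lemma le_gand p q z : p <= gand q z <-> p <= q /\ p <= z.
Proof. by rewrite /gand le_min; split=> /andP. Qed.

(** Quantifying over thresholds [r] turns the inequalities of a bisimulation into transfers of lower
    bounds. *)
Lemma gand_le p q z :
  gand p q <= z <-> forall r, r <= p -> r <= q -> r <= z.
Proof.
split=> [h r rp rq|]; last by apply; rewrite /gand ge_min lexx ?orbT.
by apply: le_trans h; apply/le_gand.
Qed.

(** Handles suprema that need not be attained: if [b < z], truncating [v] at [z] gives
    [Num.min z v <= b], hence [v <= b]. The bound [0 <= b] covers the empty set, whose [sup] is
    0. *)
Lemma le_sup_elim A z b p : 0 <= b ->
  (forall v r, A v -> r <= z -> r <= v -> r <= b) ->
  p <= z -> p <= sup A -> p <= b.
Proof.
move=> b0 h pz; have [->|/set0P A0] := eqVneq A set0.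
  by rewrite sup0 => /le_trans->.
move=> pA; have [zb|bz] := leP z b; first exact: le_trans pz zb.
apply: le_trans pA _; apply: ge_sup => // v Av.
have := h v (Num.min z v) Av; rewrite !ge_min !lexx orbT (lt_geF bz) /=.
exact.
Qed.

(** Complements witnessedness, which speaks of infinite sets only. *)
Lemma finite_set_max A :
  A !=set0 -> finite_set A -> exists2 m, A m & ubound A m.
Proof.
move=> A0 /finite_seqP[s As]; rewrite {}As in A0 *.
elim: s A0 => [[x]//|a s IH _].
have [->|s0] := eqVneq s [::].
  by exists a => //=; rewrite ?inE // => x; rewrite /= inE => /eqP->.
case: IH => [|m /= ms mub].
  by case: s s0 => // b s _; exists b => /=; rewrite inE eqxx.
exists (Num.max a m) => /=.
  by rewrite inE; case: leP => _; rewrite ?eqxx // ms orbT.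
move=> x /=; rewrite inE le_max => /orP[/eqP->|/mub->]; rewrite ?lexx ?orbT//.
Qed.

(* The hypothesis [0 < p] excludes the junk value [sup set0 = 0]. *)
Lemma sup_attained A p : sup_witnessed A ->
  0 < p -> p <= sup A -> exists2 v, A v & p <= v.
Proof.
move=> wA p0 pA; have A0 : A !=set0.
  apply/set0P/eqP => AE; move: (lt_le_trans p0 pA).
  by rewrite AE sup0 ltxx.
have [m Am mub] : exists2 m, A m & ubound A m.
  by have [|/wA//] := pselect (finite_set A); apply: finite_set_max.
by exists m => //; apply: le_trans pA _; apply: ge_sup.
Qed.

End GodelTheory.

(** * The sublanguage: normal form of roles, range of values, definable connectives *)

Section Language.
Variables (R : realType) (CN RN IN : Type) (Phi : set feature).
Implicit Types (T : role R CN RN IN) (C D E : concept R CN RN IN).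
Implicit Types (J : fuzzy_interp R CN RN IN).

Local Notation const := (@CConst R CN RN IN).

Lemma basic_lang' T : basic_role Phi T -> lang'_role Phi T.
Proof. by case: T => //= -[]. Qed.

(* Inversions can be pushed to the names, and the universal role is its own
   inverse. *)
Lemma lang'_role_nf T : lang'_role Phi T ->
  (exists2 T0, basic_role Phi T0 &
     forall J (x y : dom J), reval T x y = reval T0 x y) \/
  (Phi FUniv /\ forall J (x y : dom J), reval T x y = 1).
Proof.
case; elim: T => //= [r _ _|T IH [PI lT] rT|PU _].
- by left; exists (RName _ _ _ r).
- have [[T0 bT0 T0E]|[PU TE]] := IH lT rT; last first.
    by right; split => // J x y; rewrite TE.
  left; case: T0 bT0 T0E => //= [r _ T0E|[]//= r _ T0E].
    by exists (RInv (RName _ _ _ r)) => //= J x y; rewrite T0E.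
  by exists (RName _ _ _ r) => //= J x y; rewrite T0E.
- by right.
Qed.

Lemma lang'_reval01 J T (x y : dom J) :
  lang'_role Phi T -> 0 <= reval T x y <= 1.
Proof.
case; elim: T x y => //= [r x y _ _|T IH x y [_ lT] rT|x y _ _].
- exact: rname01.
- exact: IH.
- by rewrite ler01 lexx.
Qed.

Lemma geq_vals01 (X : Type) n (f : X -> X -> R) (c : X -> R) x v :
  (forall y, 0 <= f x y <= 1) -> (forall y, 0 <= c y <= 1) ->
  geq_vals n f c x v -> 0 <= v <= 1.
Proof.
move=> f01 c01 [y _ ->]; rewrite gmin_le1 andbT; apply/le_gmin => [//|i].
by have /andP[] := gand01 (f01 (y i)) (c01 (y i)).
Qed.

Lemma ex_vals01 (X : Type) (f : X -> X -> R) (c : X -> R) x v :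
  (forall y, 0 <= f x y <= 1) -> (forall y, 0 <= c y <= 1) ->
  ex_vals f c x v -> 0 <= v <= 1.
Proof. by move=> f01 c01 [y ->]; apply: gand01. Qed.

Lemma lang'_ceval01 J C (x : dom J) :
  lang'_concept Phi C -> 0 <= ceval C x <= 1.
Proof.
case; elim: C x => //=.
- by move=> A x _ _; apply: cname01.
- by move=> a x _ _; case: ifP => _; rewrite ler01 lexx.
- by move=> r x _ _; apply: rname01.
- by move=> C IC D ID x [lC lD] [rC rD]; apply: gand01; auto.
- by move=> C IC D ID x [lC lD] [rC rD _]; apply: gimp01; auto.
- move=> T C IC x [lT lC] [rT rC]; apply: sup01 => v; apply: ex_vals01 => y.
    exact: lang'_reval01.
  exact: IC.
- move=> n T C IC x [_ bT lC] [rT rC]; apply: sup01 => v.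
  apply: geq_vals01 => y; last exact: IC.
  exact: lang'_reval01 (basic_lang' bT).
- move=> n T x [_ bT] rT; apply: sup01 => v.
  apply: geq_vals01 => y; last by rewrite ler01 lexx.
  exact: lang'_reval01 (basic_lang' bT).
Qed.

Lemma lang'_const p : 0 <= p <= 1 -> lang'_concept Phi (const p).
Proof. by []. Qed.

Lemma lang'_top : lang'_concept Phi (const 1).
Proof. by apply: lang'_const; rewrite ler01 lexx. Qed.

Lemma lang'_and C D : lang'_concept Phi C -> lang'_concept Phi D ->
  lang'_concept Phi (CAnd C D).
Proof. by case=> ? ? []. Qed.

Lemma lang'_ex T C : lang'_role Phi T -> lang'_concept Phi C ->
  lang'_concept Phi (CEx T C).
Proof. by case=> ? ? []. Qed.

(** Each arrow has a constant on one side, so this stays in the sublanguage even when no Q_n is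
    present. *)
Definition ciff_const C p := CAnd (CImp C (const p)) (CImp (const p) C).

Lemma lang'_iff_const C p : 0 <= p <= 1 -> lang'_concept Phi C ->
  lang'_concept Phi (ciff_const C p).
Proof. by move=> p01 [lC rC]; do !split => //=; tauto. Qed.

(** A single [D] works in all interpretations, so its value can be compared across two of them. The
    bound [p <= 1] is for the empty conjunction, the constant 1. *)
Lemma finite_conj (L : set (concept R CN RN IN)) :
  finite_set L -> L `<=` lang'_concept Phi ->
  exists2 D, lang'_concept Phi D & forall J (x : dom J) p, p <= 1 ->
    (p <= ceval D x <-> forall C, L C -> p <= ceval C x).
Proof.
move=> /(@finite_seqP {classic (concept R CN RN IN)})[s ->].
elim: s => [_|C s IH Cs].
  by exists (const 1) => [|J x p p1 /=]; [exact: lang'_top | split].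
have [D lD DE] : exists2 D, lang'_concept Phi D &
    forall J (x : dom J) p, p <= 1 ->
    (p <= ceval D x <->
     forall C, [set` s : seq {classic (concept R CN RN IN)}] C ->
       p <= ceval C x).
  by apply: IH => E /= Es; apply: Cs; rewrite /= inE Es orbT.
exists (CAnd C D) => [|J x p p1 /=].
  by apply: lang'_and => //; apply: Cs; rewrite /= inE eqxx.
rewrite /gand le_min; split.
  move=> /andP[pC /(DE _ _ _ p1) pD] E; rewrite inE => /orP[/eqP->//|Es].
  exact: pD.
move=> h; apply/andP; split; first by apply: h; rewrite inE eqxx.
by apply/DE => // E /= Es; apply: h; rewrite inE Es orbT.
Qed.

Lemma finite_disj n k (F : 'I_k -> concept R CN RN IN) : Phi (FQual n) ->
  (forall j, lang'_concept Phi (F j)) ->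
  exists2 D, lang'_concept Phi D & forall J (x : dom J),
    ceval D x = \big[Num.max/0]_(j < k) ceval (F j) x.
Proof.
move=> Pn; elim: k F => [|k IH] F lF.
  exists (const 0) => [|J x]; last by rewrite big_ord0.
  by apply: lang'_const; rewrite lexx ler01.
have [D lD DE] := IH (fun j => F (lift ord0 j)) (fun j => lF _).
pose C := F ord0; have lC : lang'_concept Phi C by exact: lF.
exists (CAnd (CImp (CImp C D) D) (CImp (CImp D C) C)).
  case: lC lD => lC rC [lD rD].
  by do !split => //=; left; exists n.
move=> J x; rewrite big_ord_recl -DE /= -/C; apply: gimp_join.
- by have /andP[] := lang'_ceval01 x lC.
- by have /andP[] := lang'_ceval01 x lD.
Qed.

End Language.

(** * Invariance of concepts under bisimulations *)

Section Invariance.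
Variables (R : realType) (CN RN IN : Type) (Phi : set feature).
Implicit Types (T : role R CN RN IN) (C D E : concept R CN RN IN).
Implicit Types (I : fuzzy_interp R CN RN IN).

(** The clauses come in forth and back pairs or are symmetric, so proving transfer in one direction
    suffices. *)
Lemma fuzzy_bisim_sym I I' (Z : dom I -> dom I' -> R) :
  fuzzy_bisim Phi Z -> fuzzy_bisim Phi (fun x' x => Z x x').
Proof.
case=> Z01 Zname Zforth Zback Znom ? ? Zself ? ? ? ?.
split; try by move=> *; auto.
- by move=> x' x A; rewrite giffC.
- by move=> PO x' x a xa; apply: (Znom PO x x' a); tauto.
- by move=> PS x' x r; rewrite giffC; apply: Zself.
Qed.

(** The induction generalizes over both interpretations and [Z], because the case of an implication
    carries the antecedent from [x'] back to [x] along the converse bisimulation. *)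
Lemma bisim_ceval I I' (Z : dom I -> dom I' -> R) C x x' p :
  fuzzy_bisim Phi Z -> lang'_concept Phi C ->
  p <= Z x x' -> p <= ceval C x -> p <= ceval C x'.
Proof.
move=> bZ [lC rC]; elim: C I I' Z x x' p bZ lC rC => //=.
- move=> A I I' Z x x' p bZ _ _ pZ pA.
  have := bisim_name bZ x x' A; have /andP[_ Z1] := bisim01 bZ x x'.
  by rewrite le_giff // => /andP[/gand_le + _]; apply.
- move=> a I I' Z x x' p bZ PO _ pZ.
  case: asboolP => xa; case: asboolP => xa' // p0.
    move: pZ; rewrite (bisim_nom bZ PO (a := a)) //; tauto.
  exact: le_trans p0 ler01.
- move=> r I I' Z x x' p bZ PS _ pZ pr.
  have := bisim_self bZ PS x x' r; have /andP[_ Z1] := bisim01 bZ x x'.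
  by rewrite le_giff // => /andP[/gand_le + _]; apply.
- move=> C IC D ID I I' Z x x' p bZ [lC lD] [rC rD] pZ /le_gand[pC pD].
  apply/le_gand; split; first exact: (IC _ _ _ _ _ _ bZ lC rC pZ pC).
  exact: (ID _ _ _ _ _ _ bZ lD rD pZ pD).
- move=> C IC D ID I I' Z x x' p bZ [lC lD] [rC rD _] pZ.
  have /andP[_ Z1] := bisim01 bZ x x'.
  rewrite !le_gimp ?(le_trans pZ Z1)// => /gand_le pCD.
  apply/gand_le => r rp rC'; have rZ := le_trans rp pZ.
  apply: (ID _ _ _ _ _ _ bZ lD rD rZ); apply: pCD => //.
  exact: (IC _ _ _ _ _ _ (fuzzy_bisim_sym bZ) lC rC rZ rC').
- move=> T C IC I I' Z x x' p bZ [lT lC] [rT rC] pZ.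
  have T01 J (u v : dom J) : 0 <= reval T u v <= 1.
    exact: (lang'_reval01 u v (conj lT rT)).
  have C01 J (u : dom J) : 0 <= ceval C u <= 1.
    exact: (lang'_ceval01 u (conj lC rC)).
  have ex01 v : ex_vals (reval T) (ceval C) x' v -> 0 <= v <= 1.
    exact: ex_vals01.
  apply: le_sup_elim (pZ); first by have /andP[] := sup01 ex01.
  move=> _ r [y ->] rZ /le_gand[rT' rC'].
  have [y' /gand_le hy'] : exists y',
      gand (Z x x') (reval T x y) <= gand (Z y y') (reval T x' y').
    (* A basic role is matched by the forth clause, a role that is constantly 1 by the clause for
       U. *)
    have [[T0 bT0 T0E]|[PU TE]] := lang'_role_nf (conj lT rT).
      by have [y'] := bisim_forth bZ x x' bT0 y; exists y'; rewrite !T0E.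
    have [y' hy'] := bisim_univ_forth bZ PU x x' y; exists y'.
    rewrite !TE; apply/gand_le => q qZ q1; apply/le_gand.
    by split=> //; apply: le_trans hy'.
  have /le_gand[rZ' rT''] := hy' r rZ rT'.
  apply: le_trans (le_sup01 (v := gand (reval T x' y') (ceval C y')) ex01 _).
    by apply/le_gand; split=> //; apply: (IC _ _ _ _ _ _ bZ lC rC rZ' rC').
  by exists y'.
- move=> n T C IC I I' Z x x' p bZ [Pn bT lC] [_ rC] pZ.
  have geq01 v : geq_vals n (reval T) (ceval C) x' v -> 0 <= v <= 1.
    apply: geq_vals01 => u; first exact: lang'_reval01 (basic_lang' bT).
    exact: (lang'_ceval01 u (conj lC rC)).
  have /andP[sup0 _] := sup01 geq01.
  apply: le_sup_elim (pZ) => // _ r [y yI ->] rZ rF.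
  (* The counting clause requires positive values of [Z] and of the role; a threshold [r <= 0] is
     below any supremum of truth values. *)
  have [r0|r0] := leP r 0; first exact: le_trans r0 sup0.
  have hy j : r <= reval T x (y j) /\ r <= ceval C (y j).
    exact/le_gand/(le_trans rF)/gmin_le.
  have r1 : r <= 1 := le_trans rF (gmin_le1 _).
  have [j|y' y'I hy'] := bisim_qual_forth bZ Pn bT (lt_le_trans r0 rZ) yI.
    exact: lt_le_trans r0 (hy j).1.
  apply: le_trans (le_sup01 (v := gmin (fun i =>
    gand (reval T x' (y' i)) (ceval C (y' i)))) geq01 _); last by exists y'.
  (* Several [i] may share one [j]: since all [y j] satisfy the bound on [C], no matching is
     required. *)
  apply/le_gmin => // i; have [j /gand_le hij] := hy' i.
  have /le_gand[rZ' rT'] : r <= gand (Z (y j) (y' i)) (reval T x' (y' i)).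
    by apply: hij => //; apply/le_gmin => // k; apply: (hy k).1.
  apply/le_gand; split=> //.
  exact: (IC _ _ _ _ _ _ bZ lC rC rZ' (hy j).2).
- move=> n T I I' Z x x' p bZ [Pn bT] _ pZ.
  have geq01 v : geq_vals n (reval T) (fun=> 1) x' v -> 0 <= v <= 1.
    apply: geq_vals01 => u; first exact: lang'_reval01 (basic_lang' bT).
    by rewrite ler01 lexx.
  have /andP[sup0 _] := sup01 geq01.
  apply: le_sup_elim (pZ) => // _ r [y yI ->] rZ rF.
  have [r0|r0] := leP r 0; first exact: le_trans r0 sup0.
  have hy j : r <= reval T x (y j) /\ r <= 1.
    exact/le_gand/(le_trans rF)/gmin_le.
  have r1 : r <= 1 := le_trans rF (gmin_le1 _).
  have [j|y' y'I hy'] := bisim_num_forth bZ Pn bT (lt_le_trans r0 rZ) yI.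
    exact: lt_le_trans r0 (hy j).1.
  apply: le_trans (le_sup01 (v := gmin (fun i =>
    gand (reval T x' (y' i)) 1)) geq01 _); last by exists y'.
  apply/le_gmin => // i; apply/le_gand; split=> //.
  have /gand_le := hy' i; apply=> //.
  by apply/le_gmin => // k; apply: (hy k).1.
Qed.

End Invariance.

(** * Logical similarity and its back and forth properties *)

Section HennessyMilner.
Variables (R : realType) (CN RN IN : Type) (Phi : set feature).
Implicit Types (T : role R CN RN IN) (C D E : concept R CN RN IN).
Implicit Types (I : fuzzy_interp R CN RN IN).

Definition logsim I I' (x : dom I) (x' : dom I') : R :=
  inf [set giff (ceval C x) (ceval C x') | C in lang'_concept Phi].

Lemma logsimC I I' (x : dom I) (x' : dom I') : logsim x x' = logsim x' x.
Proof.
by congr inf; apply/seteqP; split=> _ [C lC <-]; exists C => //; apply: giffC.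
Qed.

Lemma logsim_le I I' C (x : dom I) (x' : dom I') : lang'_concept Phi C ->
  logsim x x' <= giff (ceval C x) (ceval C x').
Proof.
move=> lC; apply: ge_inf; last by exists C.
exists 0 => _ [D lD <-].
by have /andP[] := giff01 (lang'_ceval01 x lD) (lang'_ceval01 x' lD).
Qed.

Lemma le_logsim I I' (x : dom I) (x' : dom I') p :
  (forall C, lang'_concept Phi C -> p <= giff (ceval C x) (ceval C x')) ->
  p <= logsim x x'.
Proof.
move=> h; apply: lb_le_inf => [|_ [C lC <-]]; last exact: h.
exists (giff 1 1), (CConst CN RN IN 1) => //.
exact: lang'_top.
Qed.

Lemma logsim01 I I' (x : dom I) (x' : dom I') : 0 <= logsim x x' <= 1.
Proof.
apply/andP; split.
  apply: le_logsim => C lC.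
  by have /andP[] := giff01 (lang'_ceval01 x lC) (lang'_ceval01 x' lC).
apply: le_trans (logsim_le x x' (@lang'_top R CN RN IN Phi)) _.
by rewrite /= giffxx.
Qed.

Lemma logsim_ceval I I' C (x : dom I) (x' : dom I') p : lang'_concept Phi C ->
  p <= logsim x x' -> p <= ceval C x -> p <= ceval C x'.
Proof.
move=> lC pZ; have := logsim_le x x' lC; have /andP[_ Z1] := logsim01 x x'.
by rewrite le_giff // => /andP[/gand_le + _]; apply.
Qed.

(** Apply the hypothesis to [ciff_const C c] with [c] the value of [C] at [x]: it has value 1 at
    [x], and its value at [x'] is the equivalence of the two values of [C]. *)
Lemma le_logsim_valid I I' (x : dom I) (x' : dom I') p :
  (forall E, lang'_concept Phi E -> ceval E x = 1 -> p <= ceval E x') ->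
  p <= logsim x x'.
Proof.
move=> h; apply: le_logsim => C lC; rewrite giffC.
have /= := h _ (lang'_iff_const (lang'_ceval01 x lC) lC); apply.
exact: giffxx.
Qed.

(** Saturation applies to infinite sets only. The concepts [q -> q] with [q = 1/(n+1)] are pairwise
    distinct, valid everywhere and in the sublanguage for every [Phi]. *)
Lemma infinite_valid (G : set (concept R CN RN IN)) :
  (forall E, lang'_concept Phi E ->
     (forall I (x : dom I), ceval E x = 1) -> G E) ->
  infinite_set G.
Proof.
move=> hG.
pose f (n : nat) : concept R CN RN IN :=
  CImp (CConst _ _ _ n.+1%:R^-1) (CConst _ _ _ n.+1%:R^-1).
move=> finG; apply: infinite_nat.
have <- : f @^-1` G = [set: nat].
  apply/seteqP; split=> // n _; apply: hG => [|I x /=].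
    have n01 : 0 <= (n.+1%:R^-1 : R) <= 1.
      by rewrite invr_ge0 ler0n invf_le1 ?ltr0Sn ?ler1n.
    by do !split => //=; right; left.
  by rewrite /gimp lexx.
apply: finite_preimage finG => m n _ _ [/invr_inj/eqP].
by rewrite eqr_nat => /eqP[].
Qed.

Lemma logsim_forth I I' (x : dom I) (x' : dom I') T y :
  witnessed I' Phi -> modally_saturated I' Phi -> basic_role Phi T ->
  exists y',
    gand (logsim x x') (reval T x y) <= gand (logsim y y') (reval T x' y').
Proof.
move=> wI' sI' bT; have lT := basic_lang' bT.
set p := gand (logsim x x') (reval T x y).
have [pZ pT] : p <= logsim x x' /\ p <= reval T x y by apply/le_gand.
have /andP[_ Z1] := logsim01 x x'; have p1 := le_trans pZ Z1.
(* Saturation asks for a positive threshold; for [p <= 0] any element will do. *)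
have [p0|p0] := leP p 0.
  have [y'] := dom_inhabited I'; exists y'; apply: le_trans p0 _.
  apply/le_gand; split; first by have /andP[] := logsim01 y y'.
  by have /andP[] := lang'_reval01 x' y' lT.
pose G := [set E | lang'_concept Phi E /\ ceval E y = 1].
have GL : G `<=` lang'_concept Phi by move=> E [].
have Ginf : infinite_set G by apply: infinite_valid => E lE vE; split.
have p01 : 0 < p <= 1 by rewrite p0.
have [L LG finL|y' hy'] := msat_role sI' (x := x') p01 bT GL Ginf _.
  have [D lD DE] := finite_conj finL (subset_trans LG GL).
  have lTD := lang'_ex lT lD.
  have pD : p <= ceval (CEx T D) x'.
    apply: logsim_ceval lTD pZ _ => /=.
    apply: le_trans (le_sup01 (v := gand (reval T x y) (ceval D y)) _ _).
    - by apply/le_gand; split=> //; apply/DE => // C /LG[_ ->].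
    - by move=> v; apply: ex_vals01 => u;
        [apply: lang'_reval01 lT | apply: lang'_ceval01 lD].
    - by exists y.
  have [_ [y' ->] /le_gand[pT' pD']] := sup_attained (wI'.2 _ lTD x') p0 pD.
  by exists y' => C LC; apply/le_gand; split=> //; apply: (DE _ _ _ p1).1 LC.
exists y'; apply/le_gand; split.
  by apply: le_logsim_valid => E lE Ey; have /le_gand[] := hy' E (conj lE Ey).
(* The constant 1 lies in [G], which yields the bound on the role value. *)
by have /le_gand[] := hy' _ (conj (@lang'_top _ _ _ _ Phi) erefl).
Qed.

(** The universal role is not basic, so this case rests on [msat_univ]; the concept [exists U.D]
    carries the value of [D] at [y] to [x] and then across to [x']. *)
Lemma logsim_univ_forth I I' (x : dom I) (x' : dom I') (y : dom I) :
  Phi FUniv ->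
  witnessed I' Phi -> modally_saturated I' Phi ->
  exists y' : dom I', logsim x x' <= logsim y y'.
Proof.
move=> PU wI' sI'; set p := logsim x x'.
have lT : lang'_role Phi (RUniv R CN RN IN) by [].
have /andP[_ p1] := logsim01 x x'.
have [p0|p0] := leP p 0.
  have [y'] := dom_inhabited I'; exists y'; apply: le_trans p0 _.
  by have /andP[] := logsim01 y y'.
pose G := [set E | lang'_concept Phi E /\ ceval E y = 1].
have GL : G `<=` lang'_concept Phi by move=> E [].
have Ginf : infinite_set G by apply: infinite_valid => E lE vE; split.
have p01 : 0 < p <= 1 by rewrite p0.
have [L LG finL|y' hy'] := msat_univ sI' PU p01 GL Ginf _.
  have [D lD DE] := finite_conj finL (subset_trans LG GL).
  have lTD := lang'_ex lT lD.
  have pD : p <= ceval (CEx (RUniv R CN RN IN) D) x'.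
    apply: logsim_ceval lTD (lexx _) _ => /=.
    apply: le_trans (le_sup01 (v := gand 1 (ceval D y)) _ _).
    - by apply/le_gand; split=> //; apply/DE => // C /LG[_ ->].
    - move=> v; apply: ex_vals01 => u; last exact: lang'_ceval01 lD.
      by rewrite ler01 lexx.
    - by exists y.
  have [_ [y' ->] /le_gand[_ pD']] := sup_attained (wI'.2 _ lTD x') p0 pD.
  by exists y' => C; apply: (DE _ _ _ p1).1.
by exists y'; apply: le_logsim_valid => E lE Ey; apply: hy'.
Qed.

Lemma logsim_qual_forth I I' (x : dom I) (x' : dom I') T n (y : 'I_n -> dom I) :
  Phi (FQual n) -> witnessed I' Phi -> modally_saturated I' Phi ->
  basic_role Phi T -> 0 < logsim x x' -> injective y ->
  (forall j, 0 < reval T x (y j)) ->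
  exists2 y' : 'I_n -> dom I', injective y' & forall i, exists j,
    gand (logsim x x') (gmin (fun k => reval T x (y k)))
      <= gand (logsim (y j) (y' i)) (reval T x' (y' i)).
Proof.
move=> Pn wI' sI' bT Z0 yI T0; have lT := basic_lang' bT.
set p := gand _ _.
have [pZ pT] : p <= logsim x x' /\ p <= gmin (fun k => reval T x (y k)).
  exact/le_gand.
have /andP[_ Z1] := logsim01 x x'; have p1 := le_trans pZ Z1.
have p0 : 0 < p.
  by rewrite /p /gand lt_min Z0; apply/bigmin_gtP; split=> //; apply: ltr01.
pose G := [set E | lang'_concept Phi E /\ forall j, ceval E (y j) = 1].
have GL : G `<=` lang'_concept Phi by move=> E [].
have Ginf : infinite_set G by apply: infinite_valid => E lE vE; split.
have p01 : 0 < p <= 1 by rewrite p0.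
have [L LG finL|y' y'I hy'] := msat_qual sI' Pn (x := x') p01 bT GL Ginf _.
  have [D lD DE] := finite_conj finL (subset_trans LG GL).
  have lTD : lang'_concept Phi (CGeQ n T D).
    by case: lD lT => lD rD [lT rT].
  have pD : p <= ceval (CGeQ n T D) x'.
    apply: logsim_ceval lTD pZ _ => /=.
    apply: le_trans (le_sup01
      (v := gmin (fun i => gand (reval T x (y i)) (ceval D (y i)))) _ _).
    - apply/le_gmin => // i; apply/le_gand; split.
        exact: le_trans pT (gmin_le _ _).
      by apply/DE => // C /LG[_ ->].
    - by move=> v; apply: geq_vals01 => u;
        [apply: lang'_reval01 lT | apply: lang'_ceval01 lD].
    - by exists y.
  have [_ [y' y'I ->] /(le_gmin _ p1) py'] :=
    sup_attained (wI'.2 _ lTD x') p0 pD.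
  exists y' => // i C LC; have /le_gand[pT' pD'] := py' i.
  by apply/le_gand; split=> //; apply: (DE _ _ _ p1).1 LC.
(* Otherwise every [y j] has similarity below [p] to [y' i], as the role value is at least [p]. *)
exists y' => // i; apply: contrapT => /forallNP hi.
have pT' : p <= reval T x' (y' i).
  by have /le_gand[] := hy' i _ (conj (@lang'_top _ _ _ _ Phi) (fun=> erefl)).
(* The contrapositive of [le_logsim_valid] separates each [y j] from [y' i]. *)
have /choice[F hF] : forall j, exists E, [/\ lang'_concept Phi E,
    ceval E (y j) = 1 & ceval E (y' i) < p].
  move=> j; apply: contrapT => /forallNP hj; apply: (hi j); apply/le_gand.
  split=> //; apply: le_logsim_valid => E lE Ey.
  rewrite leNgt; apply/negP => Ep.
  by apply: (hj E).
have [D lD DE] := finite_disj Pn (fun j => let: And3 lF _ _ := hF j in lF).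
have /le_gand[_] : p <= gand (reval T x' (y' i)) (ceval D (y' i)).
  (* The disjunction is in [G]: at [y j] its disjunct [F j] already has value 1. *)
  apply: hy'; split=> // j; apply/le_anti/andP; split.
    by have /andP[] := lang'_ceval01 (y j) lD.
  by have [_ <- _] := hF j; rewrite DE; apply: le_bigmax.
(* All disjuncts are below [p] at [y' i], and so is the initial value 0 of the maximum since
   [0 < p]. *)
rewrite leNgt => /negP; apply; rewrite DE; apply/bigmax_ltP; split=> // j _.
by case: (hF j).
Qed.

(** The successors need not be similar, so the points attaining the value of [CGeN n T] at [x'] are
    as required. *)
Lemma logsim_num_forth I I' (x : dom I) (x' : dom I') T n (y : 'I_n -> dom I) :
  Phi (FNum n) -> witnessed I' Phi ->
  basic_role Phi T -> 0 < logsim x x' -> injective y ->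
  (forall j, 0 < reval T x (y j)) ->
  exists2 y' : 'I_n -> dom I', injective y' & forall i,
    gand (logsim x x') (gmin (fun k => reval T x (y k))) <= reval T x' (y' i).
Proof.
move=> Pn wI' bT Z0 yI T0; have lT := basic_lang' bT.
set p := gand _ _.
have [pZ pT] : p <= logsim x x' /\ p <= gmin (fun k => reval T x (y k)).
  exact/le_gand.
have /andP[_ Z1] := logsim01 x x'; have p1 := le_trans pZ Z1.
have p0 : 0 < p.
  by rewrite /p /gand lt_min Z0; apply/bigmin_gtP; split=> //; apply: ltr01.
have lTn : lang'_concept Phi (CGeN n T) by case: lT.
have pD : p <= ceval (CGeN n T) x'.
  apply: logsim_ceval lTn pZ _ => /=.
  apply: le_trans (le_sup01
    (v := gmin (fun i => gand (reval T x (y i)) 1)) _ _).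
  - apply/le_gmin => // i; apply/le_gand; split=> //.
    exact: le_trans pT (gmin_le _ _).
  - move=> v; apply: geq_vals01 => u; first exact: lang'_reval01 lT.
    by rewrite ler01 lexx.
  - by exists y.
have [_ [y' y'I ->] /(le_gmin _ p1) py'] :=
  sup_attained (wI'.2 _ lTn x') p0 pD.
by exists y' => // i; have /le_gand[] := py' i.
Qed.

End HennessyMilner.

Theorem theorem4 (R : realType) (CN RN IN : Type)
    (Phi : set feature) (hPhi : Phi `<=` features)
    (I I' : fuzzy_interp R CN RN IN)
    (wI : witnessed I Phi) (wI' : witnessed I' Phi)
    (sI : modally_saturated I Phi) (sI' : modally_saturated I' Phi)
    (Z : dom I -> dom I' -> R)
    (hZ : forall (x : dom I) (x' : dom I'),
       Z x x' = inf [set giff (ceval C x) (ceval C x')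
                    | C in lang'_concept Phi]) :
  fuzzy_bisim Phi Z /\
  (forall Z' : dom I -> dom I' -> R, fuzzy_bisim Phi Z' ->
     forall (x : dom I) (x' : dom I'), Z' x x' <= Z x x').
Proof.
have -> : Z = logsim Phi (I := I) (I' := I').
  by apply/funext => x; apply/funext => x'; apply: hZ.
split; last first.
  move=> Z' bZ' x x'; have /andP[_ Z1] := bisim01 bZ' x x'.
  apply: le_logsim => C lC; rewrite le_giff //.
  apply/andP; split; apply/gand_le => p pZ; first exact: bisim_ceval bZ' lC pZ.
  exact: bisim_ceval (fuzzy_bisim_sym bZ') lC pZ.
split.
- exact: logsim01.
- by move=> x x' A; apply: (logsim_le x x' (C := CName R RN IN A)).
- by move=> x x' T bT y; apply: logsim_forth.
(* As similarity is symmetric, each back clause is the forth property with [I] and [I']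
   exchanged. *)
- move=> x x' T bT y'; have [y hy] := logsim_forth x' x y' wI sI bT.
  by exists y; rewrite (logsimC _ x x') (logsimC _ y y').
- move=> PO x x' a xa.
  (* If exactly one of the points is named by [a], the nominal has values 1 and 0, whose equivalence
     is 0. *)
  have := logsim_le x x' (C := CNom R CN RN a) (conj PO Logic.I).
  have /andP[Z0 _] := logsim01 Phi x x'.
  rewrite /= /giff /gimp /gand.
  by case: asboolP => ?; case: asboolP => ?; [tauto| | |tauto];
    rewrite ?lexx ?ler01 ler10 ?minEle ?ler01 ?ler10 => Z1;
    apply/le_anti/andP.
- by move=> PU x x' y; apply: logsim_univ_forth.
- move=> PU x x' y'; have [y hy] := logsim_univ_forth x' x y' PU wI sI.
  by exists y; rewrite (logsimC _ x x') (logsimC _ y y').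
- move=> PS x x' r.
  exact: (logsim_le x x' (C := CSelf R CN IN r) (conj PS Logic.I)).
- by move=> n Pn x x' T bT Z0 y yI T0; apply: logsim_qual_forth.
- move=> n Pn x x' T bT; rewrite logsimC => Z0 y' y'I T0.
  have [y yI hy] := logsim_qual_forth Pn wI sI bT Z0 y'I T0.
  by exists y => // i; have [j] := hy i; exists j; rewrite (logsimC _ (y i)).
- by move=> n Pn x x' T bT Z0 y yI T0; apply: logsim_num_forth.
- move=> n Pn x x' T bT; rewrite logsimC => Z0 y' y'I T0.
  exact: logsim_num_forth.
Qed.
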